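(* If $x>0$, then $$-\gamma+x\psi'\biggl(1+\frac{x}2\biggr)<\psi(x+1) <-\gamma+x\psi'\bigl(\sqrt{x+1}\,\bigr).$$ If $-1<x<0$, the inequalities are reversed, that is, $$-\gamma+x\psi'\biggl(1+\frac{x}2\biggr)>\psi(x+1) >-\gamma+x\psi'\bigl(\sqrt{x+1}\,\bigr).$$
   Context: $\Gamma$ is Euler's gamma function, $\psi(x)=\Gamma'(x)/\Gamma(x)$ is the psi (digamma) function, $\psi'$ is its derivative, and $\gamma=0.577\ldots$ is the Euler–Mascheroni constant. *)

(* Defs.v *)
From Stdlib Require Import Reals.
From Coquelicot Require Import Coquelicot.
Open Scope R_scope.

(* Euler's integral of the second kind over (0, +oo), improper at both ends.
   It converges exactly when x > 0; the value elsewhere is meaningless. *)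
Definition Gamma (x : R) : R :=
  RInt_gen (fun t : R => Rpower t (x - 1) * exp (- t))
           (at_right 0) (Rbar_locally p_infty).

(* Like [Gamma], meaningful for x > 0 only. *)
Definition psi (x : R) : R := Derive Gamma x / Gamma x.

(* The limit of 1 + 1/2 + ... + 1/m - ln m, with m = n + 1. *)
Definition euler_mascheroni : R :=
  real (Lim_seq (fun n : nat =>
    sum_n (fun k : nat => / INR (S k)) n - ln (INR (S n)))).

(* Main.v *)
Require Import Defs.
From Stdlib Require Import Reals Lra.
From Coquelicot Require Import Coquelicot.
Open Scope R_scope.

(** For [x > -1] the classical expansions

      psi (x + 1) = - gamma + x * sum 1 / ((1 + k) * (x + 1 + k)),
      psi' y = sum 1 / (y + k)^2                      (k = 0, 1, ...)

    the second one for [y > 0], turn the theorem into a comparison of series,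
    term by term. For [x <> 0] the product [(1 + k) * (x + 1 + k)] is below the
    square of the arithmetic mean [1 + x / 2 + k] of its factors
    ([midpoint_term_lt]) and, by Cauchy-Schwarz, at least the square of
    [sqrt (x + 1) + k] ([sqrt_term_le]). Hence the series in the expansion of
    [psi (x + 1)] lies strictly between the two values of psi'
    ([Derive_psi_bounds]), and the sign of the factor [x] decides the direction
    of the inequalities.

    The work is to derive the expansions from Euler's integral. The integral
    is never differentiated in its parameter. Instead, Bernoulli's inequality
    under the integral sign gives [Gamma (a + mu) >= a^mu * Gamma a] for
    [mu <= 0] or [mu >= 1] ([Gamma_shift_ge]), and with
    [Gamma (x + 1) = x * Gamma x] this confines the slope of the secant of
    log Gamma from [b] to [a], where [1 < b < a], between [ln (b - 1)] and
    [ln a] ([log_Gamma_slope]). So an increment of log Gamma at [x + n] is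
    [h * ln n] up to an error that vanishes as [n] grows, while the functional
    equation expresses the increment at [x] by the one at [x + n] and a sum of
    increments of [ln]. Letting [n] tend to infinity,

      | log Gamma (x + h) - log Gamma x - h * digamma x | <= C * h^2

    where [digamma] is the expansion above ([log_Gamma_increment_error]). Such
    a quadratic error yields the derivative at once, and the same device
    differentiates [digamma] ([is_derive_digamma]). *)

(** * Elementary inequalities *)

Lemma ln_le_pred u : 0 < u -> ln u <= u - 1.
Proof.
  intros Hu. generalize (exp_ineq1_le (ln u)). rewrite exp_ln by exact Hu. lra.
Qed.

Lemma ln_ge_inv u : 0 < u -> 1 - / u <= ln u.
Proof.
  intros Hu. generalize (ln_le_pred (/ u) (Rinv_0_lt_compat _ Hu)).
  rewrite ln_Rinv by exact Hu. lra.
Qed.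

(** The maximum of [s * ln t - t] is at [t = s]; the factor [exp (- s)] that the
    maximum also carries is dropped. *)
Lemma Rpower_exp_bound s t :
  0 < s -> 0 < t -> Rpower t s * exp (- t) <= Rpower s s.
Proof.
  intros Hs Ht. unfold Rpower. rewrite <- exp_plus.
  assert (H : s * ln t + - t <= s * ln s).
  { assert (Hq : 0 < t / s) by (apply Rdiv_lt_0_compat; lra).
    generalize (ln_le_pred _ Hq). rewrite ln_div by lra. intros H.
    apply (Rmult_le_compat_l s) in H; [|lra].
    replace (s * (t / s - 1)) with (t - s) in H by (field; lra). lra. }
  destruct H as [H|H]; [left; now apply exp_increasing | right; now f_equal].
Qed.

(** From [exp v >= 1 + v]. For [mu <= 0] it combines with [ln u <= u - 1]; for
    [1 <= mu] that bound points the wrong way, so one factor [u] is taken out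
    and [u * ln u >= u - 1] is used instead. *)
Lemma Rpower_bernoulli u mu :
  0 < u -> mu <= 0 \/ 1 <= mu -> 1 + mu * (u - 1) <= Rpower u mu.
Proof.
  intros Hu [Hm|Hm].
  - unfold Rpower. generalize (exp_ineq1_le (mu * ln u)) (ln_le_pred u Hu). nra.
  - replace mu with (1 + (mu - 1)) at 2 by ring.
    rewrite Rpower_plus, Rpower_1 by exact Hu. unfold Rpower.
    assert (H1 := exp_ineq1_le ((mu - 1) * ln u)).
    assert (H2 : u - 1 <= u * ln u).
    { apply Rle_trans with (u * (1 - / u)); [right; field; lra|].
      apply Rmult_le_compat_l; [lra | now apply ln_ge_inv]. }
    apply Rle_trans with (u * (1 + (mu - 1) * ln u)); [nra|].
    apply Rmult_le_compat_l; lra.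
Qed.

(** * Improper integrals over the half-line *)

Lemma filter_prod_half_line (P : R * R -> Prop) :
  (forall a b, 0 < a < b -> P (a, b)) ->
  filter_prod (at_right 0) (Rbar_locally p_infty) P.
Proof.
  intros HP. apply Filter_prod with (fun a => 0 < a < 1) (fun b => 1 < b).
  - exists (mkposreal 1 Rlt_0_1); intros y Hy Hy0; apply Rabs_def2 in Hy;
    unfold minus, plus, opp in Hy; simpl in Hy; lra.
  - now exists 1.
  - intros a b Ha Hb. apply HP. lra.
Qed.

(** Bounded partial integrals of a nonnegative function increase with the
    interval, so the improper integral is their supremum. The second
    conjunct, that it dominates every partial integral, gives positivity of
    Gamma. *)
Lemma is_RInt_gen_half_line_pos (f : R -> R) (M : R) :
  (forall t, 0 < t -> continuous f t) ->
  (forall t, 0 < t -> 0 <= f t) ->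
  (forall a b, 0 < a <= b -> RInt f a b <= M) ->
  exists l, is_RInt_gen f (at_right 0) (Rbar_locally p_infty) l /\
    forall a b, 0 < a <= b -> RInt f a b <= l.
Proof.
  intros Hc Hp HM.
  assert (Hex : forall a b, 0 < a -> 0 < b -> ex_RInt f a b).
  { intros a b Ha Hb. apply (ex_RInt_continuous (V := R_CompleteNormedModule)).
    intros z Hz. apply Hc. generalize (Rmin_glb_lt _ _ _ Ha Hb). lra. }
  set (E := fun y => exists a b, 0 < a <= b /\ y = RInt f a b).
  destruct (completeness E) as [l [Hub Hl]].
  { exists M. intros y (a & b & Hab & ->). now apply HM. }
  { exists (RInt f 1 1), 1, 1. split; [lra | reflexivity]. }
  exists l. assert (Hle : forall a b, 0 < a <= b -> RInt f a b <= l).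
  { intros a b Hab. apply Hub. now exists a, b. }
  split; [|exact Hle].
  intros P [eps HP].
  assert (Hnear : exists a b, 0 < a <= b /\ l - eps < RInt f a b).
  { apply Classical_Prop.NNPP. intros Hno.
    assert (H : l <= l - eps); [|destruct eps; simpl in *; lra].
    apply Hl. intros y (a & b & Hab & ->).
    apply Rnot_lt_le. intros Hlt. apply Hno. now exists a, b. }
  (* All larger intervals have integrals between that one and [l]. *)
  destruct Hnear as (a0 & b0 & Hab0 & Hnear).
  apply Filter_prod with (fun a => 0 < a < a0) (fun b => b0 < b).
  - assert (Ha0 : 0 < a0) by lra. exists (mkposreal a0 Ha0). intros y Hy Hy0.
    apply Rabs_def2 in Hy. unfold minus, plus, opp in Hy; simpl in Hy. lra.
  - now exists b0.
  - intros a b Ha Hb. exists (RInt f a b). split.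
    + apply (RInt_correct (V := R_CompleteNormedModule)). simpl. apply Hex; lra.
    + apply HP.
      assert (Hs : RInt f a b = RInt f a a0 + (RInt f a0 b0 + RInt f b0 b)).
      { rewrite <- (RInt_Chasles (V := R_CompleteNormedModule) f a a0 b),
          <- (RInt_Chasles (V := R_CompleteNormedModule) f a0 b0 b); try (apply Hex; lra). reflexivity. }
      assert (0 <= RInt f a a0) by (apply RInt_ge_0; [lra | apply Hex; lra | intros; apply Hp; lra]).
      assert (0 <= RInt f b0 b) by (apply RInt_ge_0; [lra | apply Hex; lra | intros; apply Hp; lra]).
      assert (RInt f a b <= l) by (apply Hle; lra).
      change (Rabs (RInt f a b - l) < eps). apply Rabs_def1; destruct eps; simpl in *; lra.
Qed.

Lemma is_RInt_gen_half_line_ge_0 (f : R -> R) (l : R) :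
  (forall t, 0 < t -> 0 <= f t) ->
  is_RInt_gen f (at_right 0) (Rbar_locally p_infty) l -> 0 <= l.
Proof.
  intros Hf Hl. apply Rle_trans with (norm l); [apply norm_ge_0|].
  (* The norm inequality compares [f] with itself: |l| <= l. *)
  refine (RInt_gen_norm f f l l _ _ Hl Hl); apply filter_prod_half_line; simpl.
  - intros; lra.
  - intros a b Hab t Ht. right. apply Rabs_pos_eq, Hf. lra.
Qed.

Lemma is_RInt_gen_half_line_unique (f : R -> R) (l : R) :
  is_RInt_gen f (at_right 0) (Rbar_locally p_infty) l ->
  RInt_gen f (at_right 0) (Rbar_locally p_infty) = l.
Proof. exact (is_RInt_gen_unique (V := R_CompleteNormedModule) f l). Qed.

(** * Convergence of Euler's integral *)

Definition gamma_integrand (x t : R) : R := Rpower t (x - 1) * exp (- t).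

Lemma continuous_gamma_integrand x t : 0 < t -> continuous (gamma_integrand x) t.
Proof.
  intros Ht. apply (ex_derive_continuous (V := R_NormedModule)).
  unfold gamma_integrand, Rpower. auto_derive. lra.
Qed.

Lemma gamma_integrand_pos x t : 0 < gamma_integrand x t.
Proof. apply Rmult_lt_0_compat; apply exp_pos. Qed.

(** One majorant serves both ends of the half-line: the derivative of
    [(t / (1 + t)) ^ x], which is [x * t^(x-1) * (1 + t)^(-x-1)], behaves like
    [t^(x-1)] at 0 and like [1 / t^2] at infinity, and its primitive is bounded
    by 1. It dominates the integrand up to a constant because
    [(1 + t)^(x+1) * exp (- (1 + t))] is bounded. *)
Lemma RInt_gamma_integrand_bounded x :
  0 < x -> exists M, forall a b, 0 < a <= b -> RInt (gamma_integrand x) a b <= M.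
Proof.
  intros Hx. set (K := exp 1 * Rpower (x + 1) (x + 1)).
  set (H := fun t => K / x * exp (x * (ln t - ln (1 + t)))).
  set (h := fun t => K / (t * (1 + t)) * exp (x * (ln t - ln (1 + t)))).
  assert (HK : 0 < K) by (apply Rmult_lt_0_compat; apply exp_pos).
  exists (K / x). intros a b Hab.
  assert (Hmin : Rmin a b = a) by (apply Rmin_left; lra).
  assert (Hmax : Rmax a b = b) by (apply Rmax_right; lra).
  assert (Hh : is_RInt h a b (H b - H a)).
  { apply (is_RInt_derive H h); rewrite Hmin, Hmax; intros t Ht.
    - unfold H, h. auto_derive; [lra|]. unfold Rminus. field; lra.
    - apply (ex_derive_continuous (V := R_NormedModule)). unfold h. auto_derive. repeat split; nra || lra. }
  apply Rle_trans with (RInt h a b).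
  - apply RInt_le; [lra | | now exists (H b - H a) |].
    + apply (ex_RInt_continuous (V := R_CompleteNormedModule)). rewrite Hmin.
      intros t Ht. apply continuous_gamma_integrand. lra.
    + intros t Ht.
      assert (Hb := Rpower_exp_bound (x + 1) (1 + t) ltac:(lra) ltac:(lra)).
      (* Write the integrand as the bounded factor times the shape of [h]. *)
      assert (E : gamma_integrand x t =
        exp 1 * (Rpower (1 + t) (x + 1) * exp (- (1 + t)))
          * (/ (t * (1 + t)) * exp (x * (ln t - ln (1 + t))))).
      { unfold gamma_integrand, Rpower.
        replace (/ (t * (1 + t))) with (exp (- (ln t + ln (1 + t)))).
        - rewrite <- !exp_plus. f_equal. ring.
        - rewrite <- ln_mult, exp_Ropp, exp_ln by nra. reflexivity. }
      rewrite E. unfold h, Rdiv. rewrite Rmult_assoc with (r1 := K).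
      apply Rmult_le_compat_r.
      * apply Rmult_le_pos; [left; apply Rinv_0_lt_compat; nra | left; apply exp_pos].
      * unfold K. apply Rmult_le_compat_l; [left; apply exp_pos | exact Hb].
  - rewrite (is_RInt_unique _ _ _ _ Hh).
    assert (0 < H a).
    { apply Rmult_lt_0_compat; [apply Rdiv_lt_0_compat; lra | apply exp_pos]. }
    assert (H b <= K / x); [|lra].
    rewrite <- (Rmult_1_r (K / x)). apply Rmult_le_compat_l.
    + left. apply Rdiv_lt_0_compat; lra.
    + left. apply Rlt_le_trans with (exp 0); [|rewrite exp_0; lra]. apply exp_increasing.
      assert (ln b < ln (1 + b)) by (apply ln_increasing; lra). nra.
Qed.

Lemma is_RInt_gen_Gamma x : 0 < x ->
  is_RInt_gen (gamma_integrand x) (at_right 0) (Rbar_locally p_infty) (Gamma x)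
  /\ 0 < Gamma x.
Proof.
  intros Hx. destruct (RInt_gamma_integrand_bounded x Hx) as [M HM].
  destruct (is_RInt_gen_half_line_pos (gamma_integrand x) M) as (l & Hl & Hle).
  - apply continuous_gamma_integrand.
  - intros t _. left. apply gamma_integrand_pos.
  - exact HM.
  - assert (E : Gamma x = l).
    { exact (is_RInt_gen_half_line_unique _ _ Hl). }
    rewrite E. split; [exact Hl|].
    apply Rlt_le_trans with (RInt (gamma_integrand x) 1 2); [|apply Hle; lra].
    apply RInt_gt_0; [lra | intros; apply gamma_integrand_pos|].
    intros; apply continuous_gamma_integrand; lra.
Qed.

Lemma Gamma_pos x : 0 < x -> 0 < Gamma x.
Proof. apply is_RInt_gen_Gamma. Qed.

(** * Functional equation and growth of Gamma *)

Lemma filterlim_boundary_0 x : 0 < x ->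
  filterlim (fun t => Rpower t x * exp (- t)) (at_right 0) (locally 0).
Proof.
  intros Hx P [eps HP].
  exists (mkposreal (Rpower eps (/ x)) (exp_pos _)). intros t Ht Ht0.
  apply HP. apply Rabs_def2 in Ht. unfold minus, plus, opp in Ht; simpl in Ht.
  change (Rabs (Rpower t x * exp (- t) - 0) < eps).
  assert (Hpos : 0 < Rpower t x * exp (- t)) by (apply Rmult_lt_0_compat; apply exp_pos).
  rewrite Rminus_0_r, Rabs_pos_eq by lra.
  apply Rlt_le_trans with (Rpower t x * 1).
  - apply Rmult_lt_compat_l; [apply exp_pos|]. rewrite <- exp_0. apply exp_increasing. lra.
  - rewrite Rmult_1_r. destruct eps as [eps Heps]; simpl in *.
    replace eps with (Rpower (Rpower eps (/ x)) x).
    + apply Rle_Rpower_l; [lra|]. lra.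
    + rewrite Rpower_mult, Rinv_l, Rpower_1 by lra. reflexivity.
Qed.

(** One more power of [t] is still bounded against [exp (- t)], so the product
    is at most a constant divided by [t]. *)
Lemma filterlim_boundary_p_infty x : 0 < x ->
  filterlim (fun t => Rpower t x * exp (- t)) (Rbar_locally p_infty) (locally 0).
Proof.
  intros Hx P [eps HP]. set (K := Rpower (x + 1) (x + 1)).
  assert (HK : 0 < K) by apply exp_pos. destruct eps as [eps Heps]; simpl in *.
  exists (K / eps). intros t Ht.
  assert (Ht0 : 0 < t) by (apply Rlt_trans with (K / eps); [apply Rdiv_lt_0_compat; lra | lra]).
  apply HP. change (Rabs (Rpower t x * exp (- t) - 0) < eps).
  assert (Hpos : 0 < Rpower t x * exp (- t)) by (apply Rmult_lt_0_compat; apply exp_pos).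
  rewrite Rminus_0_r, Rabs_pos_eq by lra.
  assert (Hb := Rpower_exp_bound (x + 1) t ltac:(lra) Ht0). fold K in Hb.
  rewrite Rpower_plus, Rpower_1 in Hb by exact Ht0.
  apply Rmult_lt_reg_l with t; [exact Ht0|].
  apply Rle_lt_trans with K; [lra|].
  apply (Rmult_lt_compat_r eps) in Ht; [|lra].
  unfold Rdiv in Ht. rewrite Rmult_assoc, Rinv_l, Rmult_1_r in Ht by lra. lra.
Qed.

(** Integration by parts, as the statement that the derivative of
    [t^x * exp (- t)], whose limits at both ends are 0, has integral 0. *)
Lemma Gamma_succ x : 0 < x -> Gamma (x + 1) = x * Gamma x.
Proof.
  intros Hx.
  set (F := fun t => Rpower t x * exp (- t)).
  set (f := fun t => x * gamma_integrand x t - gamma_integrand (x + 1) t).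
  assert (HF : forall t, 0 < t -> is_derive F t (f t)).
  { intros t Ht. unfold F, f, gamma_integrand, Rpower.
    auto_derive; [lra|].
    replace (x + 1 - 1) with x by ring.
    replace ((x - 1) * ln t) with (x * ln t + - ln t) by ring.
    rewrite exp_plus, exp_Ropp with (x := ln t), exp_ln by exact Ht. field. lra. }
  assert (Hz : is_RInt_gen f (at_right 0) (Rbar_locally p_infty) 0).
  { replace 0 with (0 - 0) at 2 by ring.
    apply is_RInt_gen_ext with (Derive F).
    - apply filter_prod_half_line. simpl. intros a b Hab t Ht.
      apply is_derive_unique, HF. rewrite Rmin_left in Ht; lra.
    - apply (is_RInt_gen_Derive F 0 0).
      + apply filter_prod_half_line. simpl. intros a b Hab t Ht.
        exists (f t). apply HF. rewrite Rmin_left in Ht; lra.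
      + apply filter_prod_half_line. simpl. intros a b Hab t Ht.
        rewrite Rmin_left in Ht by lra.
        apply continuous_ext_loc with f.
        * assert (Ht0 : 0 < t) by lra. exists (mkposreal t Ht0). intros y Hy.
          symmetry. apply is_derive_unique, HF.
          apply Rabs_def2 in Hy. unfold minus, plus, opp in Hy; simpl in Hy. lra.
        * apply (continuous_minus (V := R_NormedModule)).
          -- apply (continuous_scal_r (V := R_NormedModule)), continuous_gamma_integrand. lra.
          -- apply continuous_gamma_integrand. lra.
      + now apply filterlim_boundary_0.
      + now apply filterlim_boundary_p_infty. }
  destruct (is_RInt_gen_Gamma x Hx) as [H1 _].
  destruct (is_RInt_gen_Gamma (x + 1) ltac:(lra)) as [H2 _].
  assert (H3 := is_RInt_gen_minus _ _ _ _ (is_RInt_gen_scal _ x _ H1) H2).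
  apply is_RInt_gen_half_line_unique in H3.
  apply is_RInt_gen_half_line_unique in Hz.
  assert (E : minus (scal x (Gamma x)) (Gamma (x + 1)) = 0) by exact (eq_trans (eq_sym H3) Hz).
  change (x * Gamma x - Gamma (x + 1) = 0) in E. lra.
Qed.

(** Bernoulli's inequality at [u = t / a] bounds [t^mu] below by [a^mu] times
    an affine function of [t]; integrated against [t^(a-1) * exp (- t)], the
    affine function has mean 1 because [Gamma (a + 1) = a * Gamma a]. *)
Lemma Gamma_shift_ge a mu : 0 < a -> 0 < a + mu -> mu <= 0 \/ 1 <= mu ->
  Rpower a mu * Gamma a <= Gamma (a + mu).
Proof.
  intros Ha Ham Hmu.
  destruct (is_RInt_gen_Gamma a Ha) as [H0 _].
  destruct (is_RInt_gen_Gamma (a + 1) ltac:(lra)) as [H1 _].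
  destruct (is_RInt_gen_Gamma (a + mu) Ham) as [H2 _].
  set (c := Rpower a mu).
  assert (H := is_RInt_gen_minus _ _ _ _ H2
    (is_RInt_gen_plus _ _ _ _ (is_RInt_gen_scal _ (c * (1 - mu)) _ H0)
      (is_RInt_gen_scal _ (c * (mu / a)) _ H1))).
  apply is_RInt_gen_half_line_ge_0 in H.
  - change (0 <= Gamma (a + mu) - (c * (1 - mu) * Gamma a + c * (mu / a) * Gamma (a + 1))) in H.
    rewrite Gamma_succ in H by exact Ha.
    replace (c * (1 - mu) * Gamma a + c * (mu / a) * (a * Gamma a)) with (c * Gamma a) in H
      by (field; lra). lra.
  - intros t Ht.
    change (0 <= gamma_integrand (a + mu) t
      - (c * (1 - mu) * gamma_integrand a t + c * (mu / a) * gamma_integrand (a + 1) t)).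
    assert (Hq : 0 < t / a) by (apply Rdiv_lt_0_compat; lra).
    assert (HB := Rpower_bernoulli _ mu Hq Hmu).
    assert (E1 : gamma_integrand (a + 1) t = t * gamma_integrand a t).
    { unfold gamma_integrand. replace (a + 1 - 1) with (1 + (a - 1)) by ring.
      rewrite Rpower_plus, Rpower_1 by exact Ht. ring. }
    assert (E2 : gamma_integrand (a + mu) t = c * Rpower (t / a) mu * gamma_integrand a t).
    { unfold gamma_integrand, c. rewrite Rpower_mult_distr by lra.
      replace (a * (t / a)) with t by (field; lra).
      replace (a + mu - 1) with (mu + (a - 1)) by ring. rewrite Rpower_plus. ring. }
    rewrite E1, E2.
    replace (c * Rpower (t / a) mu * gamma_integrand a t -
      (c * (1 - mu) * gamma_integrand a t + c * (mu / a) * (t * gamma_integrand a t)))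
      with (c * gamma_integrand a t * (Rpower (t / a) mu - (1 + mu * (t / a - 1))))
      by (field; lra).
    apply Rmult_le_pos; [|lra].
    left. apply Rmult_lt_0_compat; [apply exp_pos | apply gamma_integrand_pos].
Qed.

Definition log_Gamma x := ln (Gamma x).

Lemma log_Gamma_succ x : 0 < x -> log_Gamma (x + 1) = ln x + log_Gamma x.
Proof.
  intros Hx. unfold log_Gamma. rewrite Gamma_succ by exact Hx.
  apply ln_mult; [exact Hx | now apply Gamma_pos].
Qed.

Lemma log_Gamma_shift_ge a mu : 0 < a -> 0 < a + mu -> mu <= 0 \/ 1 <= mu ->
  mu * ln a + log_Gamma a <= log_Gamma (a + mu).
Proof.
  intros Ha Ham Hmu. unfold log_Gamma.
  rewrite <- (ln_exp (mu * ln a)), <- ln_mult; try apply exp_pos; try now apply Gamma_pos.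
  apply ln_le.
  - apply Rmult_lt_0_compat; [apply exp_pos | now apply Gamma_pos].
  - now apply Gamma_shift_ge.
Qed.

(** Both bounds on the secant slope come from the same inequality: the upper
    one moves down from [a] to [b], the lower one moves up from [b - 1] to
    [a], a step of length at least 1. *)
Lemma log_Gamma_slope a b : 1 < b <= a ->
  (a - b) * ln (b - 1) <= log_Gamma a - log_Gamma b <= (a - b) * ln a.
Proof.
  intros Hab. split.
  - assert (H := log_Gamma_shift_ge (b - 1) (a - b + 1) ltac:(lra) ltac:(lra) ltac:(lra)).
    assert (H' := log_Gamma_succ (b - 1) ltac:(lra)).
    replace (b - 1 + (a - b + 1)) with a in H by ring.
    replace (b - 1 + 1) with b in H' by ring. lra.
  - assert (H := log_Gamma_shift_ge a (b - a) ltac:(lra) ltac:(lra) ltac:(lra)).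
    replace (a + (b - a)) with b in H by ring. lra.
Qed.

(** * Derivatives and series *)

(** A quadratic error on a neighbourhood gives the derivative. With it, series
    are differentiated by estimating each term, with no theorem on uniform
    convergence of derivatives. *)
Lemma is_derive_of_quadratic_error (f : R -> R) (x l C d : R) :
  0 < d ->
  (forall h, Rabs h <= d -> Rabs (f (x + h) - f x - h * l) <= C * h ^ 2) ->
  is_derive f x l.
Proof.
  intros Hd H. apply is_derive_Reals. intros eps Heps.
  assert (HC : 0 < Rabs C + 1) by (generalize (Rabs_pos C); lra).
  assert (Hdel : 0 < Rmin d (eps / (Rabs C + 1))).
  { apply Rmin_glb_lt; [exact Hd | now apply Rdiv_lt_0_compat]. }
  exists (mkposreal _ Hdel). simpl. intros h Hh0 Hh.
  assert (Hh1 := Rlt_le_trans _ _ _ Hh (Rmin_l _ _)).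
  assert (Hh2 := Rlt_le_trans _ _ _ Hh (Rmin_r _ _)).
  assert (Hhp : 0 < Rabs h) by now apply Rabs_pos_lt.
  assert (E : (f (x + h) - f x) / h - l = (f (x + h) - f x - h * l) / h) by (field; exact Hh0).
  rewrite E. unfold Rdiv. rewrite Rabs_mult, Rabs_inv.
  apply Rmult_lt_reg_r with (Rabs h); [exact Hhp|].
  rewrite Rmult_assoc, Rinv_l, Rmult_1_r by lra.
  apply Rle_lt_trans with (C * h ^ 2); [apply H; lra|].
  apply (Rmult_lt_compat_r (Rabs C + 1)) in Hh2; [|exact HC].
  unfold Rdiv in Hh2. rewrite Rmult_assoc, Rinv_l, Rmult_1_r in Hh2 by lra.
  apply Rle_lt_trans with (Rabs C * Rabs h * Rabs h).
  - rewrite <- (pow2_abs h). generalize (Rle_abs C); nra.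
  - nra.
Qed.

Lemma Series_abs_le (a b : nat -> R) :
  (forall k, Rabs (a k) <= b k) -> ex_series b -> Rabs (Series a) <= Series b.
Proof.
  intros H Hb.
  apply Rle_trans with (Series (fun k => Rabs (a k))).
  - apply Series_Rabs. apply (ex_series_le (V := R_CompleteNormedModule)) with b; [|exact Hb].
    intros k. change (Rabs (Rabs (a k)) <= b k). rewrite Rabs_Rabsolu. apply H.
  - apply Series_le; [|exact Hb]. intros k. split; [apply Rabs_pos | apply H].
Qed.

Lemma sum_n_R_S (a : nat -> R) n : sum_n a (S n) = sum_n a n + a (S n).
Proof. exact (sum_Sn a n). Qed.

Lemma sum_n_le_Series (a : nat -> R) (n : nat) :
  (forall k, 0 <= a k) -> ex_series a -> sum_n a n <= Series a.
Proof.
  intros Hp Ha. apply (is_lim_seq_incr_compare (sum_n a)).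
  - exact (Series_correct a Ha).
  - intros k. rewrite sum_n_R_S.
    generalize (Hp (S k)); lra.
Qed.

Lemma term_le_Series (a : nat -> R) (n : nat) :
  (forall k, 0 <= a k) -> ex_series a -> a n <= Series a.
Proof.
  intros Hp Ha.
  assert (Hs : forall m, 0 <= sum_n a m).
  { induction m as [|m IH]; [rewrite sum_O; apply Hp|].
    rewrite sum_n_R_S. generalize (Hp (S m)). lra. }
  apply Rle_trans with (2 := sum_n_le_Series a n Hp Ha).
  destruct n as [|n]; [rewrite sum_O; lra|].
  rewrite sum_n_R_S. generalize (Hs n). lra.
Qed.

Lemma Series_lt (a b : nat -> R) (n : nat) :
  (forall k, a k <= b k) -> a n < b n -> ex_series a -> ex_series b ->
  Series a < Series b.
Proof.
  intros Hle Hlt Ha Hb.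
  assert (H : b n - a n <= Series (fun k => b k - a k)).
  { apply (term_le_Series (fun k => b k - a k)).
    - intros k. generalize (Hle k). lra.
    - exact (ex_series_minus b a Hb Ha). }
  rewrite Series_minus in H by assumption. lra.
Qed.

(** The partial sums are bounded by telescoping
    [1 / (y + 1)^2 <= 1 / y - 1 / (y + 1)]. *)
Lemma ex_series_inv_sqr x : 0 < x -> ex_series (fun k => / (x + INR k) ^ 2).
Proof.
  intros Hx. set (a := fun k => / (x + INR k) ^ 2).
  destruct (ex_finite_lim_seq_incr (sum_n a) (/ x ^ 2 + / x)) as [l Hl].
  - intros n. rewrite sum_n_R_S.
    assert (0 < a (S n)); [|lra].
    apply Rinv_0_lt_compat, pow_lt. generalize (pos_INR (S n)); lra.
  - assert (H : forall n, sum_n a n <= / x ^ 2 + / x - / (x + INR n)).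
    { induction n as [|n IH].
      - rewrite sum_O. unfold a. simpl INR. rewrite Rplus_0_r. lra.
      - rewrite sum_n_R_S.
        assert (a (S n) <= / (x + INR n) - / (x + INR (S n))); [|lra].
        unfold a. rewrite S_INR. assert (Hn := pos_INR n). set (y := x + INR n).
        replace (x + (INR n + 1)) with (y + 1) by (unfold y; ring).
        assert (Hy : 0 < y) by (unfold y; lra).
        replace (/ y - / (y + 1)) with (/ (y * (y + 1))) by (field; lra).
        apply Rinv_le_contravar; nra. }
    intros n. apply Rle_trans with (1 := H n).
    assert (0 < / (x + INR n)); [|lra].
    apply Rinv_0_lt_compat. generalize (pos_INR n); lra.
  - exists l. exact Hl.
Qed.

Lemma ex_series_inv_mul x y : 0 < x -> 0 < y ->
  ex_series (fun k => / ((x + INR k) * (y + INR k))).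
Proof.
  intros Hx Hy.
  apply (ex_series_le (V := R_CompleteNormedModule))
    with (fun k => / (x + INR k) ^ 2 + / (y + INR k) ^ 2).
  - intros k. assert (Hk := pos_INR k).
    change (Rabs (/ ((x + INR k) * (y + INR k))) <= / (x + INR k) ^ 2 + / (y + INR k) ^ 2).
    rewrite Rabs_pos_eq by (left; apply Rinv_0_lt_compat; nra).
    rewrite Rinv_mult, <- !pow_inv. nra.
  - apply (ex_series_plus (V := R_NormedModule)); now apply ex_series_inv_sqr.
Qed.

(** * The digamma series *)

(** The sequence is convergent, hence [euler_mascheroni], a total limit cut down
    to a real number, is its limit: it decreases and is nonnegative, because
    [1 / (m + 1) <= ln (m + 1) - ln m <= 1 / m]. *)
Lemma is_lim_seq_euler_mascheroni :
  is_lim_seq (fun n => sum_n (fun k => / INR (S k)) n - ln (INR (S n))) euler_mascheroni.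
Proof.
  set (u := fun n => sum_n (fun k => / INR (S k)) n - ln (INR (S n))).
  assert (Hstep : forall n, ln (INR (S (S n))) - ln (INR (S n)) <= / INR (S n) /\
    / INR (S (S n)) <= ln (INR (S (S n))) - ln (INR (S n))).
  { intros n. assert (Hm : 0 < INR (S n)) by apply lt_0_INR, Nat.lt_0_succ.
    rewrite (S_INR (S n)). set (m := INR (S n)) in *.
    assert (Hq : 0 < (m + 1) / m) by (apply Rdiv_lt_0_compat; lra).
    assert (H1 := ln_le_pred _ Hq). assert (H2 := ln_ge_inv _ Hq).
    rewrite ln_div in H1, H2 by lra.
    replace ((m + 1) / m - 1) with (/ m) in H1 by (field; lra).
    replace (1 - / ((m + 1) / m)) with (/ (m + 1)) in H2 by (field; lra). lra. }
  apply Lim_seq_correct'. apply ex_finite_lim_seq_decr with 0.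
  - intros n. unfold u; rewrite sum_n_R_S.
    generalize (Hstep n); lra.
  - intros n. change (0 <= u n).
    assert (H : ln (INR (S (S n))) <= sum_n (fun k => / INR (S k)) n).
    { induction n as [|n IH].
      - rewrite sum_O. generalize (Hstep 0%nat). simpl (INR 1). rewrite ln_1, Rinv_1. lra.
      - rewrite sum_n_R_S.
        generalize (Hstep (S n)); lra. }
    unfold u. generalize (Hstep n).
    assert (0 < / INR (S (S n))) by apply Rinv_0_lt_compat, lt_0_INR, Nat.lt_0_succ. lra.
Qed.

(** The classical expansion of psi, which agrees with [psi] on the positive
    axis by [psi_eq_digamma]. *)
Definition digamma x :=
  - euler_mascheroni + Series (fun k => / INR (S k) - / (x + INR k)).

Lemma ex_series_digamma x : 0 < x ->
  ex_series (fun k => / INR (S k) - / (x + INR k)).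
Proof.
  intros Hx.
  apply ex_series_ext with (fun k => (x - 1) * / ((1 + INR k) * (x + INR k))).
  - intros k. rewrite S_INR. generalize (pos_INR k); intros Hk.
    change ((x - 1) * / ((1 + INR k) * (x + INR k)) = / (INR k + 1) - / (x + INR k)).
    field; lra.
  - exact (ex_series_scal_l (x - 1) _ (ex_series_inv_mul 1 x Rlt_0_1 Hx)).
Qed.

(** The form in which the expansion appears when log Gamma is shifted by
    [n + 1] steps: the harmonic sums cancel against Euler's constant. *)
Lemma is_lim_seq_digamma x : 0 < x ->
  is_lim_seq (fun n => ln (INR (S n)) - sum_n (fun k => / (x + INR k)) n) (digamma x).
Proof.
  intros Hx.
  apply is_lim_seq_ext with (fun n =>
    - (sum_n (fun k => / INR (S k)) n - ln (INR (S n)))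
    + sum_n (fun k => / INR (S k) - / (x + INR k)) n).
  - intros n.
    induction n as [|n IH]; [rewrite !sum_O; ring|].
    rewrite !sum_n_R_S. lra.
  - apply is_lim_seq_plus'.
    + apply (is_lim_seq_opp _ euler_mascheroni), is_lim_seq_euler_mascheroni.
    + exact (Series_correct _ (ex_series_digamma x Hx)).
Qed.

(** * The derivative of log Gamma is the digamma series *)

(** From [1 - 1/u <= ln u <= u - 1] at [u = (y + h) / y]; the error between the
    two bounds is [h^2 / (y * (y + h))], and [y + h >= y / 2]. *)
Lemma ln_increment_error y h : 0 < y -> - y / 2 <= h ->
  Rabs (ln (y + h) - ln y - h / y) <= 2 * h ^ 2 * / y ^ 2.
Proof.
  intros Hy Hh.
  assert (Hq : 0 < (y + h) / y) by (apply Rdiv_lt_0_compat; lra).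
  assert (H1 := ln_le_pred _ Hq). assert (H2 := ln_ge_inv _ Hq).
  rewrite ln_div in H1, H2 by lra.
  replace ((y + h) / y - 1) with (h / y) in H1 by (field; lra).
  replace (1 - / ((y + h) / y)) with (h / y - h ^ 2 * / (y * (y + h))) in H2 by (field; lra).
  assert (H3 : h ^ 2 * / (y * (y + h)) <= 2 * h ^ 2 * / y ^ 2).
  { replace (2 * h ^ 2 * / y ^ 2) with (h ^ 2 * / (y * (y / 2))) by (field; lra).
    apply Rmult_le_compat_l; [apply pow2_ge_0|]. apply Rinv_le_contravar; nra. }
  rewrite Rabs_left1; lra.
Qed.

Lemma log_Gamma_add_S x n : 0 < x ->
  log_Gamma (x + INR (S n)) = log_Gamma x + sum_n (fun k => ln (x + INR k)) n.
Proof.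
  intros Hx. induction n as [|n IH].
  - rewrite sum_O. simpl INR. rewrite Rplus_0_r, log_Gamma_succ by exact Hx. ring.
  - rewrite sum_n_R_S, (S_INR (S n)), <- Rplus_assoc, log_Gamma_succ, IH.
    + ring.
    + generalize (pos_INR (S n)); lra.
Qed.

(** The range of [p] is what [log_Gamma_far_increment] needs: it contains all
    four arguments of [ln] given by [log_Gamma_slope] when [|h| <= x / 2]. *)
Lemma ln_shift_bound x p n : 0 < x ->
  x / 2 + INR n <= p <= 2 * x + INR (S n) ->
  Rabs (ln p - ln (INR (S n))) <= / (x / 2 + INR n) + 2 * x * / (1 + INR n).
Proof.
  intros Hx Hp. rewrite S_INR in *. assert (Hn := pos_INR n).
  set (m := INR n) in *.
  assert (Hq : 0 < p / (m + 1)) by (apply Rdiv_lt_0_compat; lra).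
  assert (H1 := ln_le_pred _ Hq). assert (H2 := ln_ge_inv _ Hq).
  rewrite ln_div in H1, H2 by lra.
  assert (P1 : 0 < / (x / 2 + m)) by (apply Rinv_0_lt_compat; lra).
  assert (P2 : 0 < / (1 + m)) by (apply Rinv_0_lt_compat; lra).
  assert (B1 : p / (m + 1) - 1 <= 2 * x * / (1 + m)).
  { replace (p / (m + 1) - 1) with ((p - (m + 1)) * / (1 + m)) by (field; lra).
    apply Rmult_le_compat_r; lra. }
  assert (B2 : / (p / (m + 1)) - 1 <= / (x / 2 + m)).
  { replace (/ (p / (m + 1)) - 1) with ((m + 1) * / p - 1) by (field; lra).
    assert (/ p <= / (x / 2 + m)) by (apply Rinv_le_contravar; lra).
    assert ((m + 1) * / (x / 2 + m) - 1 <= / (x / 2 + m)).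
    { replace ((m + 1) * / (x / 2 + m) - 1) with ((1 - x / 2) * / (x / 2 + m)) by (field; lra).
      nra. }
    nra. }
  assert (0 <= 2 * x * / (1 + m)) by nra.
  apply Rabs_le. lra.
Qed.

(** Far away log Gamma is almost linear on bounded intervals, with slope
    [ln n]: the secant bounds pin down the slope up to [O(1 / n)]. *)
Lemma log_Gamma_far_increment x h n : 0 < x -> Rabs h <= x / 2 ->
  Rabs (log_Gamma (x + h + INR (S n)) - log_Gamma (x + INR (S n)) - h * ln (INR (S n)))
  <= Rabs h * (/ (x / 2 + INR n) + 2 * x * / (1 + INR n)).
Proof.
  intros Hx Hh. apply Rabs_le_between in Hh.
  assert (Hn := pos_INR n).
  set (e := / (x / 2 + INR n) + 2 * x * / (1 + INR n)).
  assert (HS := S_INR n).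
  destruct (Rle_lt_dec 0 h) as [H0|H0].
  - rewrite (Rabs_pos_eq h) by exact H0.
    assert (H := log_Gamma_slope (x + h + INR (S n)) (x + INR (S n)) ltac:(lra)).
    assert (B1 := ln_shift_bound x (x + INR (S n) - 1) n Hx ltac:(lra)).
    assert (B2 := ln_shift_bound x (x + h + INR (S n)) n Hx ltac:(lra)).
    fold e in B1, B2. apply Rabs_le_between in B1, B2. apply Rabs_le.
    replace (x + h + INR (S n) - (x + INR (S n))) with h in H by ring. nra.
  - rewrite (Rabs_left h) by exact H0.
    assert (H := log_Gamma_slope (x + INR (S n)) (x + h + INR (S n)) ltac:(lra)).
    assert (B1 := ln_shift_bound x (x + h + INR (S n) - 1) n Hx ltac:(lra)).
    assert (B2 := ln_shift_bound x (x + INR (S n)) n Hx ltac:(lra)).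
    fold e in B1, B2. apply Rabs_le_between in B1, B2. apply Rabs_le.
    replace (x + INR (S n) - (x + h + INR (S n))) with (- h) in H by ring. nra.
Qed.

Lemma is_lim_seq_inv_shift c : 0 < c -> is_lim_seq (fun n => / (c + INR n)) 0.
Proof.
  intros Hc. replace (Finite 0) with (Rbar_inv p_infty) by reflexivity.
  apply is_lim_seq_inv; [|easy].
  apply is_lim_seq_plus with c p_infty; [apply is_lim_seq_const | apply is_lim_seq_INR | easy].
Qed.

(** Shift by [n + 1] with the functional equation, replace the far increment
    by [h * ln (n + 1)] and each increment of [ln] by its linear part. The
    quadratic errors sum to at most [2 * h^2 * sum 1 / (x + k)^2], uniformly in
    [n], and the other errors vanish as [n] tends to infinity. *)
Lemma log_Gamma_increment_error x h : 0 < x -> Rabs h <= x / 2 ->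
  Rabs (log_Gamma (x + h) - log_Gamma x - h * digamma x)
  <= 2 * Series (fun k => / (x + INR k) ^ 2) * h ^ 2.
Proof.
  intros Hx Hh. assert (Hh' := proj1 (Rabs_le_between _ _) Hh).
  set (Q := Series (fun k => / (x + INR k) ^ 2)).
  set (A := log_Gamma (x + h) - log_Gamma x - h * digamma x).
  set (e := fun n => Rabs h * (/ (x / 2 + INR n) + 2 * x * / (1 + INR n))).
  set (d := fun n => ln (INR (S n)) - sum_n (fun k => / (x + INR k)) n).
  set (r := fun k => ln (x + h + INR k) - ln (x + INR k) - h / (x + INR k)).
  assert (Hr : forall n, Rabs (sum_n r n) <= 2 * h ^ 2 * Q).
  { intros n. apply Rle_trans with (sum_n (fun k => 2 * h ^ 2 * / (x + INR k) ^ 2) n).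
    - apply Rle_trans with (sum_n (fun k => Rabs (r k)) n).
      + exact (norm_sum_n_m r 0 n).
      + apply sum_n_m_le. intros k. assert (Hk := pos_INR k). unfold r.
        replace (x + h + INR k) with (x + INR k + h) by ring.
        apply ln_increment_error; lra.
    - unfold Q. rewrite <- Series_scal_l. apply sum_n_le_Series.
      + intros k. apply Rmult_le_pos; [generalize (pow2_ge_0 h); lra|].
        left. apply Rinv_0_lt_compat, pow_lt. generalize (pos_INR k); lra.
      + exact (ex_series_scal_l (2 * h ^ 2) _ (ex_series_inv_sqr x Hx)). }
  (* The left side does not depend on [n], so the bound passes to the limit. *)
  assert (Hn : forall n, Rabs A <= 2 * h ^ 2 * Q + (e n + Rabs h * Rabs (d n - digamma x))).
  { intros n.
    assert (E : A = (log_Gamma (x + h + INR (S n)) - log_Gamma (x + INR (S n)) - h * ln (INR (S n)))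
      - sum_n r n + h * (d n - digamma x)).
    { rewrite !log_Gamma_add_S by lra.
      assert (Es : sum_n (fun k => ln (x + h + INR k)) n
        - sum_n (fun k => ln (x + INR k)) n - h * sum_n (fun k => / (x + INR k)) n = sum_n r n).
      { clear. induction n as [|n IH]; [rewrite !sum_O; unfold r, Rdiv; ring|].
        rewrite !sum_n_R_S, <- IH. unfold r, Rdiv. ring. }
      rewrite <- Es. unfold A, d. ring. }
    rewrite E.
    assert (T1 := log_Gamma_far_increment x h n Hx Hh). fold (e n) in T1.
    assert (T2 := Hr n).
    eapply Rle_trans; [apply Rabs_triang|]. rewrite Rabs_mult.
    eapply Rle_trans; [apply Rplus_le_compat_r, Rabs_triang|]. rewrite Rabs_Ropp. lra. }
  replace (2 * Q * h ^ 2) with (2 * h ^ 2 * Q + (Rabs h * (0 + 2 * x * 0) + Rabs h * 0)) by ring.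
  refine (is_lim_seq_le _ _ (Finite (Rabs A)) (Finite _) Hn (is_lim_seq_const _) _).
  apply is_lim_seq_plus'; [apply is_lim_seq_const|].
  apply is_lim_seq_plus'.
  - apply (is_lim_seq_scal_l _ (Rabs h) (Finite (0 + 2 * x * 0))).
    apply is_lim_seq_plus'; [apply is_lim_seq_inv_shift; lra|].
    apply (is_lim_seq_scal_l _ (2 * x) (Finite 0)). apply is_lim_seq_inv_shift; lra.
  - apply (is_lim_seq_scal_l _ (Rabs h) (Finite 0)).
    apply (is_lim_seq_abs_0 (fun n => d n - digamma x)).
    replace (Finite 0) with (Finite (digamma x - digamma x)) by (f_equal; ring).
    apply is_lim_seq_minus'; [now apply is_lim_seq_digamma | apply is_lim_seq_const].
Qed.

Lemma is_derive_log_Gamma x : 0 < x -> is_derive log_Gamma x (digamma x).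
Proof.
  intros Hx.
  apply is_derive_of_quadratic_error with (2 * Series (fun k => / (x + INR k) ^ 2)) (x / 2); [lra|].
  intros h Hh. now apply log_Gamma_increment_error.
Qed.

Lemma locally_pos x : 0 < x -> locally x (fun y => 0 < y).
Proof. intros Hx. exact (open_gt 0 x Hx). Qed.

Lemma psi_eq_digamma x : 0 < x -> psi x = digamma x.
Proof.
  intros Hx. assert (HG := Gamma_pos x Hx).
  assert (HD : is_derive Gamma x (digamma x * Gamma x)).
  { apply is_derive_ext_loc with (fun y => exp (log_Gamma y)).
    - generalize (locally_pos x Hx). apply filter_imp. intros y Hy.
      apply exp_ln. now apply Gamma_pos.
    - assert (H := is_derive_comp exp log_Gamma x _ _ (is_derive_exp _) (is_derive_log_Gamma x Hx)).
      unfold log_Gamma in H at 2. rewrite exp_ln in H by exact HG. exact H. }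
  unfold psi. rewrite (is_derive_unique _ _ _ HD). field. lra.
Qed.

(** * The trigamma series *)

Lemma is_derive_digamma x : 0 < x ->
  is_derive digamma x (Series (fun k => / (x + INR k) ^ 2)).
Proof.
  intros Hx. set (Q := Series (fun k => / (x + INR k) ^ 2)).
  apply is_derive_of_quadratic_error with (2 / x * Q) (x / 2); [lra|].
  intros h Hh. apply Rabs_le_between in Hh.
  assert (HQ := ex_series_inv_sqr x Hx).
  assert (H1 := ex_series_digamma x Hx).
  assert (H2 := ex_series_digamma (x + h) ltac:(lra)).
  assert (E : digamma (x + h) - digamma x - h * Q = Series (fun k =>
    (/ INR (S k) - / (x + h + INR k)) - (/ INR (S k) - / (x + INR k)) - h * / (x + INR k) ^ 2)).
  { rewrite Series_minus, Series_minus, Series_scal_l; trivial.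
    - unfold digamma, Q. ring.
    - exact (ex_series_minus _ _ H2 H1).
    - exact (ex_series_scal_l h _ HQ). }
  rewrite E. replace (2 / x * Q * h ^ 2) with (2 / x * h ^ 2 * Q) by ring.
  unfold Q. rewrite <- Series_scal_l. apply Series_abs_le.
  - intros k. assert (Hk := pos_INR k). assert (HS : 0 < INR (S k)) by apply lt_0_INR, Nat.lt_0_succ.
    set (y := x + INR k). replace (x + h + INR k) with (y + h) by (unfold y; ring).
    assert (Hy : x <= y) by (unfold y; lra).
    (* Second-order remainder of [1 / y], in closed form. *)
    assert (Ey : / INR (S k) - / (y + h) - (/ INR (S k) - / y) - h * / y ^ 2
      = - (/ (y + h) * h ^ 2 * / y ^ 2)) by (field; repeat split; lra).
    assert (0 < / y ^ 2) by (apply Rinv_0_lt_compat, pow_lt; lra).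
    assert (0 < / (y + h)) by (apply Rinv_0_lt_compat; lra).
    rewrite Ey, Rabs_Ropp, Rabs_pos_eq.
    + apply Rmult_le_compat_r; [lra|]. apply Rmult_le_compat_r; [apply pow2_ge_0|].
      replace (2 / x) with (/ (x / 2)) by (field; lra). apply Rinv_le_contravar; lra.
    + apply Rmult_le_pos; [|lra]. apply Rmult_le_pos; [lra | apply pow2_ge_0].
  - exact (ex_series_scal_l (2 / x * h ^ 2) _ HQ).
Qed.

Lemma Derive_psi x : 0 < x -> Derive psi x = Series (fun k => / (x + INR k) ^ 2).
Proof.
  intros Hx. apply is_derive_unique. apply is_derive_ext_loc with digamma.
  - generalize (locally_pos x Hx). apply filter_imp. intros y Hy. symmetry. now apply psi_eq_digamma.
  - now apply is_derive_digamma.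
Qed.

(** * Comparison of the series *)

Lemma psi_add_1 x : -1 < x ->
  psi (x + 1) = - euler_mascheroni
    + x * Series (fun k => / ((1 + INR k) * (x + 1 + INR k))).
Proof.
  intros Hx. rewrite psi_eq_digamma by lra. unfold digamma.
  rewrite <- Series_scal_l. f_equal. apply Series_ext. intros k. rewrite S_INR.
  generalize (pos_INR k); intros. field. lra.
Qed.

(** The arithmetic-geometric mean inequality for [1 + m] and [x + 1 + m],
    whose mean is [1 + x / 2 + m]. *)
Lemma midpoint_term_lt x m : -1 < x -> x <> 0 -> 0 <= m ->
  / (1 + x / 2 + m) ^ 2 < / ((1 + m) * (x + 1 + m)).
Proof.
  intros Hx Hx0 Hm.
  assert (0 < x ^ 2) by (apply pow2_gt_0; exact Hx0).
  apply Rinv_lt_contravar.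
  - apply Rmult_lt_0_compat; [nra | apply pow_lt; lra].
  - nra.
Qed.

(** With [s = sqrt (x + 1)] one has
    [(1 + m) * (s^2 + m) = (s + m)^2 + m * (s - 1)^2]; hence the terms agree at
    [m = 0] and the inequality is strict afterwards. *)
Lemma sqrt_term_le x m : -1 < x -> x <> 0 -> 0 <= m ->
  / ((1 + m) * (x + 1 + m)) <= / (sqrt (x + 1) + m) ^ 2 /\
  (0 < m -> / ((1 + m) * (x + 1 + m)) < / (sqrt (x + 1) + m) ^ 2).
Proof.
  intros Hx Hx0 Hm.
  assert (Hs := sqrt_lt_R0 (x + 1) ltac:(lra)).
  assert (Es := sqrt_sqrt (x + 1) ltac:(lra)).
  set (s := sqrt (x + 1)) in *.
  assert (Hamgm : 0 < (s - 1) ^ 2).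
  { apply pow2_gt_0. intros H. apply Hx0. nra. }
  assert (E : (1 + m) * (x + 1 + m) = (s + m) ^ 2 + m * (s - 1) ^ 2).
  { replace x with (s * s - 1) by lra. ring. }
  assert (Hpos : 0 < (s + m) ^ 2) by (apply pow_lt; lra).
  rewrite E. split.
  - apply Rinv_le_contravar; nra.
  - intros Hm0. apply Rinv_lt_contravar; nra.
Qed.

Lemma Derive_psi_bounds x : -1 < x -> x <> 0 ->
  Derive psi (1 + x / 2) < Series (fun k => / ((1 + INR k) * (x + 1 + INR k))) /\
  Series (fun k => / ((1 + INR k) * (x + 1 + INR k))) < Derive psi (sqrt (x + 1)).
Proof.
  intros Hx Hx0. assert (Hs := sqrt_lt_R0 (x + 1) ltac:(lra)).
  rewrite !Derive_psi by lra.
  assert (Hm := ex_series_inv_mul 1 (x + 1) ltac:(lra) ltac:(lra)).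
  split.
  - apply Series_lt with 0%nat; trivial.
    + intros k. left. apply midpoint_term_lt; trivial. apply pos_INR.
    + apply midpoint_term_lt; trivial. apply pos_INR.
    + apply ex_series_inv_sqr. lra.
  (* The terms of index 0 coincide, so strictness is witnessed at index 1. *)
  - apply Series_lt with 1%nat; trivial.
    + intros k. apply sqrt_term_le; trivial. apply pos_INR.
    + apply sqrt_term_le; trivial; simpl; lra.
    + now apply ex_series_inv_sqr.
Qed.

Theorem theorem3 :
  (forall x : R, 0 < x ->
     - euler_mascheroni + x * Derive psi (1 + x / 2) < psi (x + 1) /\
     psi (x + 1) < - euler_mascheroni + x * Derive psi (sqrt (x + 1))) /\
  (forall x : R, -1 < x < 0 ->
     - euler_mascheroni + x * Derive psi (1 + x / 2) > psi (x + 1) /\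
     psi (x + 1) > - euler_mascheroni + x * Derive psi (sqrt (x + 1))).
Proof.
  split; intros x Hx; rewrite psi_add_1 by lra;
    destruct (Derive_psi_bounds x) as [Hl Hu]; try lra;
    split; apply Rplus_lt_compat_l; nra.
Qed.
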